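(* Let $A$ and $B$ be simple types, and let $L_A\subseteq\mathrm{Tm}(A)$ and $L_B\subseteq\mathrm{Tm}(B)$ be regular higher-order languages. Define $$L_A\times L_B=\{\,P\in\mathrm{Tm}(A\times B)\mid \pi_1P\in L_A,\ \pi_2P\in L_B\,\}$$ (equivalently, the set of pairs $(M,N)$ with $M\in L_A$, $N\in L_B$, since every closed term of type $A\times B$ is $\beta\eta$-equal to a pair), and $$L_A\Rightarrow L_B=\{\,M\in\mathrm{Tm}(A\Rightarrow B)\mid \forall P\in\mathrm{Tm}(A),\ P\in L_A\Rightarrow MP\in L_B\,\}.$$ Then $L_A\times L_B$ is a regular higher-order language of type $A\times B$ and $L_A\Rightarrow L_B$ is a regular higher-order language of type $A\Rightarrow B$.
   Context: Simple types are generated by the grammar $A,B::=A\times B\mid A\Rightarrow B\mid 1\mid o$ with a single base type $o$. For a simple type $A$, $\mathrm{Tm}(A)$ denotes the set of closed simply-typed $\lambda$-terms (with pairing, projections $\pi_1,\pi_2$ and a unit term) of type $A$, taken modulo $\beta\eta$-conversion. A higher-order language of type $A$ is a subset $L\subseteq\mathrm{Tm}(A)$. For a finite set $Q$, let $[\![-]\!]_Q$ be the standard interpretation of types and terms in the cartesian closed category of finite sets, with $[\![o]\!]_Q=Q$. A language $L\subseteq\mathrm{Tm}(A)$ is $Q$-regular if there is a subset $F\subseteq[\![A]\!]_Q$ with $L=\{M\in\mathrm{Tm}(A)\mid [\![M]\!]_Q\in F\}$; $L$ is regular if it is $Q$-regular for some finite set $Q$. *)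

(* Defs.v *)
From mathcomp Require Import all_boot.
Set Implicit Arguments.
Unset Strict Implicit.
Unset Printing Implicit Defensive.

Inductive ty : Type :=
| Base
| Unit
| Prod (A B : ty)
| Arr (A B : ty).

(* Intrinsically typed de Bruijn syntax; a context lists the types of the
   free variables, the most recently bound one first. *)
Inductive var : seq ty -> ty -> Type :=
| vz G A : var (A :: G) A
| vs G A B : var G A -> var (B :: G) A.

Inductive tm : seq ty -> ty -> Type :=
| Var G A : var G A -> tm G A
| Lam G A B : tm (A :: G) B -> tm G (Arr A B)
| App G A B : tm G (Arr A B) -> tm G A -> tm G B
| Pair G A B : tm G A -> tm G B -> tm G (Prod A B)
| Fst G A B : tm G (Prod A B) -> tm G A
| Snd G A B : tm G (Prod A B) -> tm G B
| Star G : tm G Unit.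
Arguments vz {G A}.
Arguments Star {G}.

Definition renaming (G D : seq ty) : Type := forall A, var G A -> var D A.
Definition subst (G D : seq ty) : Type := forall A, var G A -> tm D A.

Definition vcase (G : seq ty) (B : ty) (T : ty -> Type)
    (t : T B) (s : forall A, var G A -> T A) (A : ty) (x : var (B :: G) A) :
    T A :=
  match x in var G' A' return
    match G' with
    | [::] => unit
    | B' :: G0 => T B' -> (forall A, var G0 A -> T A) -> T A'
    end
  with
  | vz _ _ => fun t _ => t
  | vs _ _ _ y => fun _ s => s _ y
  end t s.

Definition up_ren (G D : seq ty) (B : ty) (r : renaming G D) :
    renaming (B :: G) (B :: D) :=
  vcase (T := var (B :: D)) vz (fun A x => vs B (r A x)).

Fixpoint ren (G : seq ty) (A : ty) (M : tm G A) :
    forall D, renaming G D -> tm D A :=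
  match M with
  | Var _ _ x => fun _ r => Var (r _ x)
  | Lam _ _ _ M => fun _ r => Lam (ren M (up_ren r))
  | App _ _ _ M N => fun _ r => App (ren M r) (ren N r)
  | Pair _ _ _ M N => fun _ r => Pair (ren M r) (ren N r)
  | Fst _ _ _ M => fun _ r => Fst (ren M r)
  | Snd _ _ _ M => fun _ r => Snd (ren M r)
  | Star _ => fun _ _ => Star
  end.

Definition weak (G : seq ty) (A B : ty) (M : tm G A) : tm (B :: G) A :=
  ren M (fun C (x : var G C) => vs B x).

Definition up_sub (G D : seq ty) (B : ty) (s : subst G D) :
    subst (B :: G) (B :: D) :=
  vcase (T := tm (B :: D)) (Var vz) (fun A x => weak B (s A x)).

Fixpoint sub (G : seq ty) (A : ty) (M : tm G A) :
    forall D, subst G D -> tm D A :=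
  match M with
  | Var _ _ x => fun _ s => s _ x
  | Lam _ _ _ M => fun _ s => Lam (sub M (up_sub s))
  | App _ _ _ M N => fun _ s => App (sub M s) (sub N s)
  | Pair _ _ _ M N => fun _ s => Pair (sub M s) (sub N s)
  | Fst _ _ _ M => fun _ s => Fst (sub M s)
  | Snd _ _ _ M => fun _ s => Snd (sub M s)
  | Star _ => fun _ _ => Star
  end.

Definition sub1 (G : seq ty) (A B : ty) (M : tm (B :: G) A) (N : tm G B) :
    tm G A :=
  sub M (vcase (T := tm G) N (@Var G)).

Inductive conv : forall (G : seq ty) (A : ty), tm G A -> tm G A -> Prop :=
| conv_refl G A (M : tm G A) : conv M M
| conv_sym G A (M N : tm G A) : conv M N -> conv N M
| conv_trans G A (M N P : tm G A) : conv M N -> conv N P -> conv M P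
| conv_Lam G A B (M M' : tm (A :: G) B) : conv M M' -> conv (Lam M) (Lam M')
| conv_App G A B (M M' : tm G (Arr A B)) (N N' : tm G A) :
    conv M M' -> conv N N' -> conv (App M N) (App M' N')
| conv_Pair G A B (M M' : tm G A) (N N' : tm G B) :
    conv M M' -> conv N N' -> conv (Pair M N) (Pair M' N')
| conv_Fst G A B (M M' : tm G (Prod A B)) : conv M M' -> conv (Fst M) (Fst M')
| conv_Snd G A B (M M' : tm G (Prod A B)) : conv M M' -> conv (Snd M) (Snd M')
| beta_Arr G A B (M : tm (A :: G) B) (N : tm G A) :
    conv (App (Lam M) N) (sub1 M N)
| beta_Fst G A B (M : tm G A) (N : tm G B) : conv (Fst (Pair M N)) M
| beta_Snd G A B (M : tm G A) (N : tm G B) : conv (Snd (Pair M N)) N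
| eta_Arr G A B (M : tm G (Arr A B)) : conv M (Lam (App (weak A M) (Var vz)))
| eta_Prod G A B (M : tm G (Prod A B)) : conv M (Pair (Fst M) (Snd M))
| eta_Unit G (M : tm G Unit) : conv M Star.

(* Tm(A) is the setoid (ctm A, conv): a subset of the quotient is a
   conv-closed predicate on closed terms, and two languages are the same
   when they agree pointwise. *)
Definition ctm (A : ty) : Type := tm [::] A.

Record language (A : ty) : Type := Language {
  lang_mem :> ctm A -> Prop;
  lang_conv : forall M N : ctm A, conv M N -> lang_mem M -> lang_mem N
}.

Fixpoint interp (Q : finType) (A : ty) : finType :=
  match A with
  | Base => Q
  | Unit => unit
  | Prod A B => (interp Q A * interp Q B)%type
  | Arr A B => {ffun interp Q A -> interp Q B}
  end.

Fixpoint env (Q : finType) (G : seq ty) : Type :=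
  match G with
  | [::] => unit
  | A :: G => (interp Q A * env Q G)%type
  end.

Fixpoint lookup (Q : finType) (G : seq ty) (A : ty) (x : var G A) :
    env Q G -> interp Q A :=
  match x with
  | vz _ _ => fun e => e.1
  | vs _ _ _ y => fun e => lookup y e.2
  end.

Fixpoint sem (Q : finType) (G : seq ty) (A : ty) (M : tm G A) :
    env Q G -> interp Q A :=
  match M with
  | Var _ _ x => fun e => lookup x e
  | Lam _ A B M => fun e => [ffun a : interp Q A => sem (G := A :: _) M (a, e)]
  | App _ A B M N => fun e => (sem M e : {ffun interp Q A -> interp Q B}) (sem N e)
  | Pair _ A B M N => fun e => (sem M e, sem N e)
  | Fst _ A B M => fun e => (sem M e).1
  | Snd _ A B M => fun e => (sem M e).2
  | Star _ => fun _ => tt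
  end.

Definition csem (Q : finType) (A : ty) (M : ctm A) : interp Q A :=
  sem (G := [::]) M tt.

Definition Qregular (Q : finType) (A : ty) (L : language A) : Prop :=
  exists F : {set interp Q A}, forall M : ctm A, L M <-> csem Q M \in F.

Definition regular (A : ty) (L : language A) : Prop :=
  exists Q : finType, Qregular Q L.

Lemma prod_lang_conv (A B : ty) (LA : language A) (LB : language B)
    (P P' : ctm (Prod A B)) :
  conv P P' -> LA (Fst P) /\ LB (Snd P) -> LA (Fst P') /\ LB (Snd P').
Proof.
move=> PP' [hA hB]; split.
  exact: lang_conv (conv_Fst PP') hA.
exact: lang_conv (conv_Snd PP') hB.
Qed.

Definition prod_lang (A B : ty) (LA : language A) (LB : language B) :
    language (Prod A B) :=
  Language (prod_lang_conv (LA := LA) (LB := LB)).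

Lemma arr_lang_conv (A B : ty) (LA : language A) (LB : language B)
    (M M' : ctm (Arr A B)) :
  conv M M' -> (forall P : ctm A, LA P -> LB (App M P)) ->
  forall P : ctm A, LA P -> LB (App M' P).
Proof.
move=> MM' h P hP.
exact: lang_conv (conv_App MM' (conv_refl P)) (h P hP).
Qed.

Definition arr_lang (A B : ty) (LA : language A) (LB : language B) :
    language (Arr A B) :=
  Language (arr_lang_conv (LA := LA) (LB := LB)).

Lemma prod_lang_pairs (A B : ty) (LA : language A) (LB : language B)
    (P : ctm (Prod A B)) :
  prod_lang LA LB P <->
  exists (M : ctm A) (N : ctm B), [/\ LA M, LB N & conv P (Pair M N)].
Proof.
split=> [[hA hB]|[M [N [hM hN PMN]]]].
  by exists (Fst P), (Snd P); split=> //; exact: eta_Prod.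
split.
  exact: lang_conv (conv_sym (conv_trans (conv_Fst PMN) (beta_Fst M N))) hM.
exact: lang_conv (conv_sym (conv_trans (conv_Snd PMN) (beta_Snd M N))) hN.
Qed.

(* Main.v *)
Require Import Defs.
From mathcomp Require Import all_boot.
From mathcomp Require Import boolp.

(** If [Q] injects into a nonempty finite set [Q'], then every [Q]-regular
    language is [Q']-regular: the logical relation generated by the graph of
    the injection is, at every type, a partial surjection from the [Q']-model
    onto the [Q]-model, so the [Q']-semantics of a closed term determines its
    [Q]-semantics. Two regular languages are therefore recognised by a common
    [Q], and there a term [M] belongs to [LA => LB] iff its interpretation sends
    every definable point of the set recognising [LA] into the one recognising
    [LB]. Definability is undecidable in general, but it still cuts out a subset
    of a finite set. *)

Section LogicalRelation.

Variables Q' Q : finType.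
Variable r : Q' -> Q -> Prop.

Fixpoint lrel (A : ty) : interp Q' A -> interp Q A -> Prop :=
  match A with
  | Base => r
  | Unit => fun _ _ => True
  | Prod A B => fun p q => lrel A p.1 q.1 /\ lrel B p.2 q.2
  | Arr A B => fun f g => forall a b, lrel A a b -> lrel B (f a) (g b)
  end.

Fixpoint env_lrel (G : seq ty) : env Q' G -> env Q G -> Prop :=
  match G with
  | [::] => fun _ _ => True
  | A :: G => fun d e => lrel A d.1 e.1 /\ env_lrel G d.2 e.2
  end.

Lemma lookup_lrel (G : seq ty) (A : ty) (x : var G A)
    (d : env Q' G) (e : env Q G) :
  env_lrel G d e -> lrel A (lookup x d) (lookup x e).
Proof. by elim: x d e => [G' C|G' C D y IH] d e [h1 h2] //=; exact: IH. Qed.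

(** Fundamental lemma of logical relations, valid for every [r]. *)
Lemma sem_lrel (G : seq ty) (A : ty) (M : tm G A) (d : env Q' G) (e : env Q G) :
  env_lrel G d e -> lrel A (sem M d) (sem M e).
Proof.
elim: M d e => {G A} [G A x|G A B M IH|G A B M IHM N IHN|G A B M IHM N IHN
  |G A B M IH|G A B M IH|G] d e de //=.
- exact: lookup_lrel.
- by move=> a b ab; rewrite !ffunE; exact: IH.
- exact: (IHM _ _ de) _ _ (IHN _ _ de).
- by split; [exact: IHM|exact: IHN].
- by case: (IH _ _ de).
- by case: (IH _ _ de).
Qed.

Variable q0 : Q'.
Hypothesis r_fun : forall x y z, r x y -> r x z -> y = z.
Hypothesis r_surj : forall y, exists x, r x y.

(** Supplies default values for functions at arguments related to nothing. *)
Fixpoint interp_point (A : ty) : interp Q' A :=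
  match A with
  | Base => q0
  | Unit => tt
  | Prod A B => (interp_point A, interp_point B)
  | Arr A B => [ffun=> interp_point B]
  end.

(* Functionality at [Arr A B] needs surjectivity at [A], and surjectivity at
   [Arr A B] needs functionality at [A], whence the simultaneous induction. *)
Lemma lrel_partial_surjection (A : ty) :
  (forall x y z, lrel A x y -> lrel A x z -> y = z) /\
  (forall y, exists x, lrel A x y).
Proof.
elim: A => [||A [funA surjA] B [funB surjB]|A [funA surjA] B [funB surjB]] /=.
- by [].
- by split=> [_ [] []|_] //; exists tt.
- split=> [x [y1 y2] [z1 z2] /= [xy1 xy2] [xz1 xz2]|[y1 y2]].
    by rewrite (funA _ _ _ xy1 xz1) (funB _ _ _ xy2 xz2).
  by have [x1 xy1] := surjA y1; have [x2 xy2] := surjB y2; exists (x1, x2).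
- split=> [f g h fg fh|g].
    apply/ffunP => b; have [a ab] := surjA b.
    exact: funB (fg _ _ ab) (fh _ _ ab).
  (* By functionality at [A], at most one [b] is related to [a], so a preimage of [g b] is a
     consistent choice. *)
  have /choice[f fP] (a : interp Q' A) :
      exists c : interp Q' B, forall b, lrel A a b -> lrel B c (g b).
    have [[b ab]|nab] := pselect (exists b, lrel A a b).
      have [c cgb] := surjB (g b); exists c => b' ab'.
      by rewrite (funA _ _ _ ab' ab).
    by exists (interp_point B) => b ab; case: nab; exists b.
  by exists (finfun f) => a b ab; rewrite ffunE; exact: fP.
Qed.

End LogicalRelation.

Lemma Qregular_inj (Q Q' : finType) (f : Q -> Q') (q0 : Q') (A : ty)
    (L : language A) :
  injective f -> Qregular Q L -> Qregular Q' L.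
Proof.
move=> f_inj [F LF].
pose r x y := x = f y.
have r_fun x y z : r x y -> r x z -> y = z.
  by rewrite /r => -> /f_inj.
have r_surj y : exists x, r x y by exists (f y).
have [funA _] := lrel_partial_surjection Q' Q r q0 r_fun r_surj A.
have semM M : lrel Q' Q r A (csem Q' M) (csem Q M) by exact: sem_lrel.
exists [set x | `[< exists2 y, lrel Q' Q r A x y & y \in F >]] => M.
rewrite inE LF; split=> [MF|/asboolP[y My yF]].
  by apply/asboolP; exists (csem Q M).
by rewrite (funA _ _ _ (semM M) My).
Qed.

Lemma Qregular_prod (Q : finType) (A B : ty)
    (LA : language A) (LB : language B) :
  Qregular Q LA -> Qregular Q LB ->
  Qregular Q (prod_lang LA LB).
Proof.
move=> [FA LFA] [FB LFB]; exists (setX FA FB) => P /=.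
by rewrite LFA LFB inE; split=> [[? ?]|/andP]; first exact/andP.
Qed.

Lemma Qregular_arr (Q : finType) (A B : ty)
    (LA : language A) (LB : language B) :
  Qregular Q LA -> Qregular Q LB ->
  Qregular Q (arr_lang LA LB).
Proof.
move=> [FA LFA] [FB LFB].
exists [set f : {ffun interp Q A -> interp Q B} |
  `[< forall P : ctm A, csem Q P \in FA -> f (csem Q P) \in FB >]] => M /=.
rewrite inE; split=> [LM|/asboolP FM P].
  by apply/asboolP => P /LFA /LM /LFB.
by move=> /LFA /FM MP; exact/LFB.
Qed.

Theorem theoremA (A B : ty) (LA : language A) (LB : language B) :
  regular LA -> regular LB ->
  regular (prod_lang LA LB) /\ regular (arr_lang LA LB).
Proof.
move=> [QA regA] [QB regB].
(* [None] provides the default point even when [QA] and [QB] are both empty. *)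
pose Q : finType := option (QA + QB).
have {}regA : Qregular Q LA.
  by apply: (Qregular_inj QA Q (Some \o inl) None) regA => x y [].
have {}regB : Qregular Q LB.
  by apply: (Qregular_inj QB Q (Some \o inr) None) regB => x y [].
by split; exists Q; [exact: Qregular_prod|exact: Qregular_arr].
Qed.
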